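(* Let $R$ be an $\mathcal F$-IFC domain, for a family $\mathcal F$ of prime ideals of $R$, and let $\ast:=\ast_{\mathcal F}$. The following conditions are equivalent: (i) $R$ is Clifford $\ast$-regular (respectively, $\ast$-stable); (ii) $R_P$ is Clifford regular (respectively, stable) for all $P\in\mathcal F$.
   Context: For an integral domain $R$ with field of fractions $K$, an ideal means a nonzero fractional ideal; $(J:I)=\{x\in K: xI\subseteq J\}$. A defining family for $R$ is a family $\mathcal F$ of pairwise incomparable prime ideals with $R=\bigcap_{P\in\mathcal F}R_P$. $\mathcal F$ is independent if no two (distinct) primes in $\mathcal F$ contain a common nonzero prime ideal. $R$ is an $\mathcal F$-IFC domain if $\mathcal F$ is a defining independent family for $R$ and the intersection $R=\bigcap_{P\in\mathcal F}R_P$ has finite character, i.e. each nonzero element of $R$ belongs to at most finitely many $P\in\mathcal F$. $\ast_{\mathcal F}$ is the star operation $I\mapsto I^{\ast_{\mathcal F}}=\bigcap_{P\in\mathcal F}IR_P$ on ideals of $R$. $R$ is Clifford $\ast$-regular if for every ideal $I$ there is an ideal $J$ of $R$ with $I^\ast=(I^2J)^\ast$; $R$ is $\ast$-stable if for every ideal $I$, with $E:=(I^\ast:I^\ast)$, one has $(I^\ast(E:I^\ast))^\ast=E$. Clifford regular and stable (for $R_P$) mean these properties with respect to the identity operation $I^\ast=I$. *)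

(* Defs.v *)
From HB Require Import structures.
From mathcomp Require Import all_boot all_order all_algebra.
From mathcomp Require Import boolp classical_sets functions cardinality.

Set Implicit Arguments.
Unset Strict Implicit.
Unset Printing Implicit Defensive.

Import GRing.Theory.
Local Open Scope classical_set_scope.
Local Open Scope ring_scope.

(* A domain [A] is given as a subset of a field [K], its field of fractions, so
   that the same definitions apply to [R] and to its localizations [R_P]. *)
Section FractionalIdeals.
Variable K : fieldType.
Implicit Types (A I J : set K) (star : set K -> set K).

(* "Ideal" always means nonzero fractional ideal. *)
Definition fractional_ideal A I : Prop :=
  [/\ exists2 x, I x & x != 0,
      I 0,
      forall a x y, A a -> I x -> I y -> I (a * x + y)
    & exists d, [/\ A d, d != 0 & forall x, I x -> A (d * x)]].

Definition ideal_mul I J : set K :=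
  [set x | exists (n : nat) (a b : 'I_n -> K),
     [/\ forall i, I (a i), forall i, J (b i) & x = \sum_(i < n) a i * b i]].

(* [colon J I] is (J : I), computed in K. *)
Definition colon J I : set K := [set x | forall y, I y -> J (x * y)].

Definition clifford_star_regular A star : Prop :=
  forall I, fractional_ideal A I ->
  exists2 J, fractional_ideal A J &
    star I = star (ideal_mul (ideal_mul I I) J).

Definition star_stable A star : Prop :=
  forall I, fractional_ideal A I ->
  let E := colon (star I) (star I) in
  star (ideal_mul (star I) (colon E (star I))) = E.

Definition clifford_regular A : Prop := clifford_star_regular A (fun I => I).

Definition stable A : Prop := star_stable A (fun I => I).

End FractionalIdeals.

Section DefiningFamilies.
Variable R : idomainType.
Local Notation K := {fraction R}.
Local Notation "x %:F" := (@FracField.tofrac R x).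
Implicit Types (P Q : set R) (F : set (set R)) (I : set K).

(* The image of R in its field of fractions. *)
Definition base_domain : set K := range (@FracField.tofrac R).

(* [idealr_closed] already includes properness. *)
Definition prime_ideal P : Prop :=
  idealr_closed (mem P) /\ prime_idealr_closed (mem P).

Definition localization P : set K :=
  [set x | exists a s : R, ~ P s /\ x = a%:F / s%:F].

Definition defining_family F : Prop :=
  [/\ forall P, F P -> prime_ideal P,
      forall P Q, F P -> F Q -> P `<=` Q -> P = Q
    & base_domain = \bigcap_(P in F) localization P].

Definition independent F : Prop :=
  forall P P', F P -> F P' -> P <> P' ->
  ~ exists Q, [/\ prime_ideal Q, exists2 x, Q x & x != 0, Q `<=` P & Q `<=` P'].

Definition finite_character F : Prop :=
  forall x : R, x != 0 -> finite_set [set P | F P /\ P x].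

Definition IFC_domain F : Prop :=
  [/\ defining_family F, independent F & finite_character F].

Definition star_of F I : set K :=
  \bigcap_(P in F) ideal_mul I (localization P).

End DefiningFamilies.

Arguments base_domain : clear implicits.

(* Main.v *)
(* By Zorn's lemma, independence says that for distinct P, Q in F and r <> 0
   some product s t with s outside P and t outside Q lies in rR.  Together with
   finite character this gives a gluing principle: if J_P is a fractional ideal
   of R_P for every P in F and J_P = R_P for almost all P, then the intersection
   J of the J_P is a fractional ideal of R and J R_P = J_P for all P in F.  Every
   fractional ideal I of R satisfies I R_P = R_P for almost all P, the star
   operation does not change localizations, and I* = J* if and only if
   I R_P = J R_P for all P in F.  Products commute with localization, and by
   gluing so do the colons (I* : I* ) and ((I* : I* ) : I* ).  Hence both
   properties can be tested after localizing, and every fractional ideal of R_P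
   is the localization of one of R. *)

Require Import Defs.
From mathcomp Require Import all_boot all_algebra.
From mathcomp Require Import boolp classical_sets cardinality.
From mathcomp Require Import ring.

Set Implicit Arguments.
Unset Strict Implicit.
Unset Printing Implicit Defensive.

Import GRing.Theory.

(** * Products and colons of submodules of a field *)

Section IdealProducts.
Local Open Scope classical_set_scope.
Local Open Scope ring_scope.
Variable K : fieldType.
Implicit Types (A I J L : set K).

(** The cancellation used in [glue_clear], where [b * c * u / t] is the separating factor and
    [a / b] the element to be cleared. *)
Lemma frac_swap (a b c t u : K) : t != 0 -> b != 0 ->
  b * c * u / t * (a / b) = a * u / t * c.
Proof. by move=> t0 b0; field; rewrite t0. Qed.

(** Serves as the induction principle for products: [L] may be any additively closed predicate,
    checked on generators only. *)
Lemma ideal_mul_sub I J L : L 0 -> (forall x y, L x -> L y -> L (x + y)) ->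
  (forall x y, I x -> J y -> L (x * y)) -> ideal_mul I J `<=` L.
Proof.
move=> L0 LD LM x [n [a [b [Ia Jb ->]]]].
by elim/big_ind: _ => // i _; apply: LM.
Qed.

Lemma ideal_mulM I J x y : I x -> J y -> ideal_mul I J (x * y).
Proof. by move=> Ix Jy; exists 1%N, (fun=> x), (fun=> y); rewrite big_ord1. Qed.

Lemma ideal_mul0 I J : ideal_mul I J 0.
Proof. by exists 0%N, (fun=> 0), (fun=> 0); split=> [[]|[]|] //; rewrite big_ord0. Qed.

Lemma ideal_mulD I J x y :
  ideal_mul I J x -> ideal_mul I J y -> ideal_mul I J (x + y).
Proof.
move=> [n [a [b [Ia Jb ->]]]] [m [c [d [Ic Jd ->]]]].
exists (n + m)%N,
  (fun i : 'I_(n + m) => match fintype.split i with inl j => a j | inr k => c k end),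
  (fun i : 'I_(n + m) => match fintype.split i with inl j => b j | inr k => d k end).
split=> [i|i|]; [by case: fintype.split|by case: fintype.split|].
rewrite big_split_ord /=; congr (_ + _); apply: eq_bigr => i _.
  by rewrite -[lshift m i]/(unsplit (inl i)) unsplitK.
by rewrite -[rshift n i]/(unsplit (inr i)) unsplitK.
Qed.

Lemma ideal_mulS I I' J J' :
  I `<=` I' -> J `<=` J' -> ideal_mul I J `<=` ideal_mul I' J'.
Proof.
move=> II' JJ'; apply: ideal_mul_sub; first exact: ideal_mul0.
  exact: ideal_mulD.
by move=> x y /II' I'x /JJ' J'y; apply: ideal_mulM.
Qed.

Lemma ideal_mulC : commutative (@ideal_mul K).
Proof.
suff sub I J : ideal_mul I J `<=` ideal_mul J I.
  by move=> I J; apply/seteqP.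
apply: ideal_mul_sub; [exact: ideal_mul0|exact: ideal_mulD|].
by move=> x y Ix Jy; rewrite mulrC; apply: ideal_mulM.
Qed.

Lemma ideal_mulA : associative (@ideal_mul K).
Proof.
have sub I J L : ideal_mul (ideal_mul I J) L `<=` ideal_mul I (ideal_mul J L).
  apply: ideal_mul_sub; [exact: ideal_mul0|exact: ideal_mulD|].
  move=> x y IJx Ly; move: x IJx.
  apply: ideal_mul_sub => [|x z|x z Ix Jz].
  - by rewrite mul0r; apply: ideal_mul0.
  - by rewrite mulrDl; apply: ideal_mulD.
  - by rewrite -mulrA; do 2 apply: ideal_mulM => //.
move=> I J L; apply/seteqP; split; last exact: sub.
by rewrite ideal_mulC (ideal_mulC J) (ideal_mulC _ L) (ideal_mulC I).
Qed.

Lemma ideal_mulACA : interchange (@ideal_mul K) (@ideal_mul K).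
Proof.
move=> I J L M.
by rewrite -!ideal_mulA (ideal_mulA J) (ideal_mulC J) -ideal_mulA.
Qed.

Definition submodule A I : Prop :=
  I 0 /\ forall a x y, A a -> I x -> I y -> I (a * x + y).

Definition subring A : Prop := A 1 /\ submodule A A.

Lemma submoduleM A I a x : submodule A I -> A a -> I x -> I (a * x).
Proof. by move=> [I0 IP] Aa Ix; rewrite -[_ * _]addr0; apply: IP. Qed.

Lemma submoduleD A I x y : A 1 -> submodule A I -> I x -> I y -> I (x + y).
Proof. by move=> A1 [_ IP] Ix Iy; rewrite -[x]mul1r; apply: IP. Qed.

Lemma fractional_submodule A I : fractional_ideal A I -> submodule A I.
Proof. by case. Qed.

Lemma ideal_mul_id A I : A 1 -> submodule A I -> ideal_mul I A = I.
Proof.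
move=> A1 Imod; apply/seteqP; split=> [|x Ix]; last first.
  by rewrite -[x]mulr1; apply: ideal_mulM.
apply: ideal_mul_sub; first by case: Imod.
  by move=> x y; apply: submoduleD Imod.
by move=> x a Ix Aa; rewrite mulrC; apply: submoduleM Imod _ _.
Qed.

Lemma fractional_subring A : subring A -> fractional_ideal A A.
Proof.
move=> [A1 [A0 AP]]; split=> //; first by exists 1; rewrite ?oner_neq0.
by exists 1; rewrite oner_neq0; split=> // x; rewrite mul1r.
Qed.

(** If [d] clears [I], then [d * j] carries [I] into [J]. If [e] clears [J] and [x] is in the colon,
    then [e] clears [x * i]; the extra factor [d] only serves to bring [i] into [A]. *)
Lemma fractional_colon A I J : subring A ->
  fractional_ideal A I -> fractional_ideal A J -> fractional_ideal A (colon J I).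
Proof.
move=> [A1 Amod] [[i Ii i0] I0 _ [d [Ad d0 dI]]].
move=> [[j Jj j0] J0 JP [e [Ae e0 eJ]]]; split.
- exists (d * j); last by rewrite mulf_neq0.
  move=> y Iy; rewrite mulrAC.
  by apply: (@submoduleM A) => //; apply: dI.
- by move=> y _; rewrite mul0r.
- by move=> a x y Aa Jx Jy z Iz; rewrite mulrDl -mulrA; apply: JP; auto.
- exists (e * (d * i)); split=> [||x xI].
  + by apply: submoduleM Amod _ _; last exact: dI.
  + by rewrite !mulf_neq0.
  + have -> : e * (d * i) * x = d * (e * (x * i)) by ring.
    by apply: submoduleM Amod Ad _; apply: eJ; apply: xI.
Qed.

Lemma colon_subring A : subring A -> colon A A = A.
Proof.
move=> [A1 Amod]; apply/seteqP; split=> [x /(_ _ A1)|x Ax y Ay].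
  by rewrite mulr1.
exact: submoduleM Amod _ _.
Qed.

(** A multiplier of [I] into an [A]-module also multiplies the [A]-span of [I]. Hence a colon into
    an [R_P]-module depends on [I] only through its localization. *)
Lemma colon_ideal_mul A I M : A 1 -> submodule A M ->
  colon M (ideal_mul I A) = colon M I.
Proof.
move=> A1 Mmod; apply/seteqP; split=> [x xI y Iy|x xI].
  by apply: xI; rewrite -[y]mulr1; apply: ideal_mulM.
apply: ideal_mul_sub => [|y z|y a Iy Aa].
- by rewrite mulr0; case: Mmod.
- by rewrite mulrDr; apply: submoduleD Mmod.
- by rewrite mulrA mulrC; apply: submoduleM Mmod Aa _; apply: xI.
Qed.

Lemma colon_bigcap T (F : set T) (J : T -> set K) I :
  colon (\bigcap_(P in F) J P) I = \bigcap_(P in F) colon (J P) I.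
Proof.
apply/seteqP; split=> [x xI P FP y Iy|x xI y Iy P FP]; first exact: xI.
exact: xI.
Qed.

End IdealProducts.

(** Merges finitely many local choices into one by multiplying them. It supplies both the clearing
    factor and the common denominator of a glued ideal. *)
Lemma finite_common_multiple (R : pzSemiRingType) (T : eqType) (D : set R)
    (B : set T) (C : T -> set R) :
  finite_set B -> D 1%R -> (forall s t, D s -> D t -> D (s * t)%R) ->
  (forall Q s t, C Q s -> C Q (t * s)%R /\ C Q (s * t)%R) ->
  (forall Q, B Q -> exists2 s, D s & C Q s) ->
  exists2 s, D s & forall Q, B Q -> C Q s.
Proof.
move=> /finite_seqP[r ->] D1 DM CM; elim: r => [|Q r IHr] DC.
  by exists 1%R.
have [|s Ds Cs] := IHr; first by move=> Q' rQ'; apply: DC; rewrite /= inE rQ' orbT.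
have [|t Dt Ct] := DC Q; first by rewrite /= inE eqxx.
exists (t * s)%R; first exact: DM.
move=> Q'; rewrite /= inE => /orP[/eqP->|/Cs CQ'].
  by have [] := CM _ _ s Ct.
by have [] := CM _ _ t CQ'.
Qed.

(** * Prime ideals avoiding a multiplicative set, and separation of independent primes *)

Section Primes.
Local Open Scope classical_set_scope.
Local Open Scope ring_scope.
Variable R : idomainType.
Implicit Types (P Q S : set R).

Lemma prime_idealP P : prime_ideal P <->
  [/\ P 0, ~ P 1, (forall a x y, P x -> P y -> P (a * x + y)) &
      forall x y, P (x * y) -> P x \/ P y].
Proof.
split=> [[[P0 P1 PD] PM]|[P0 P1 PD PM]].
  split=> [||a x y Px Py|x y].
  - exact/set_mem.
  - by move/mem_set; apply/negP.
  - by apply/set_mem/PD; apply/mem_set.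
  - by move/mem_set/PM/orP => [] /set_mem; [left|right].
split; first split.
- exact/mem_set.
- by apply/negP => /set_mem.
- by move=> a x y /set_mem Px /set_mem Py; apply/mem_set/PD.
- by move=> x y /set_mem/PM[] Pz; apply/orP; [left|right]; apply/mem_set.
Qed.

(** Krull's argument: an ideal maximal among those that contain [r] and avoid [S] is prime. If [x]
    and [y] were outside it, both enlarged ideals would meet [S], and the product of the two
    elements found would lie in [S] and, when [x * y] is in the ideal, in the ideal too. *)
Lemma exists_prime_avoiding S (r : R) :
  S 1 -> (forall s t, S s -> S t -> S (s * t)) -> (forall u, ~ S (r * u)) ->
  exists M, [/\ prime_ideal M, M r & forall m, M m -> ~ S m].
Proof.
move=> S1 SM rS.
(* The condition [A x -> A r] lets the empty set, which bounds the empty chain, qualify. *)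
pose good A := [/\ forall a x y, A x -> A y -> A (a * x + y),
  forall x, A x -> ~ S x & forall x, A x -> A r].
have [C CG totC|M [[MD MS Mr] Mmax]] := @Zorn_bigcup R good.
  split=> [a x y [X CX Xx] [Y CY Yy]|x [X CX Xx]|x [X CX Xx]].
  - case: (totC X Y CX CY) => [XY|YX].
    + by exists Y => //; have [YD _ _] := CG _ CY; apply: YD => //; apply: XY.
    + by exists X => //; have [XD _ _] := CG _ CX; apply: XD => //; apply: YX.
  - by have [_ XS _] := CG _ CX; apply: XS.
  - by exists X => //; have [_ _] := CG _ CX; apply; apply: Xx.
(* A maximal set without [r] would be empty, hence strictly below the ideal generated by [r], which
   is good by [rS]. *)
have {}Mr : M r.
  apply: contrapT => nMr.
  have M0 x : ~ M x by move=> /Mr.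
  apply: (Mmax [set x | exists u, x = r * u]).
    split; first by move=> x /M0.
    by move=> /(_ r) sub; apply/nMr/sub; exists 1; rewrite mulr1.
  split=> [a _ _ [u ->] [v ->]|_ [u ->]|_ _]; last by exists 1; rewrite mulr1.
  - by exists (a * u + v); ring.
  - exact: rS.
have M0 : M 0 by rewrite -[0](addNr r) -mulN1r; apply: MD.
have meetS u : ~ M u -> exists m a, M m /\ S (m + a * u).
  move=> nMu; apply: contrapT => nS.
  apply: (Mmax [set x | exists m a, M m /\ x = m + a * u]).
    split; first by move=> m Mm; exists m, 0; rewrite mul0r addr0.
    by move=> /(_ u) sub; apply/nMu/sub; exists 0, 1; split=> //; ring.
  split.
  - move=> a _ _ [m [b [Mm ->]]] [m' [b' [Mm' ->]]].
    by exists (a * m + m'), (a * b + b'); split; [exact: MD|ring].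
  - by move=> _ [m [b [Mm ->]]] Sm; apply: nS; exists m, b.
  - by move=> _ _; exists r, 0; split=> //; ring.
exists M; split=> //; apply/prime_idealP; split=> //; first by move=> /MS.
move=> x y Mxy; apply: contrapT => /not_orP[/meetS[m [a [Mm Sm]]]].
move=> /meetS[n [b [Mn Sn]]]; apply: (MS _ _ (SM _ _ Sm Sn)).
(* Expanded as a nested combination of [m], [n] and [x * y], all in [M], to match the closure
   property [MD]. *)
have -> : (m + a * x) * (n + b * y) =
  (n + b * y) * m + ((a * x) * n + ((a * b) * (x * y) + 0)) by ring.
by do 3 apply: (MD) => //.
Qed.

(** The products [s * t] with [s] outside [P] and [t] outside [Q] form a multiplicative set. If it
    missed all multiples of [r], some prime containing [r] would avoid it; taking [t = 1] or
    [s = 1], that prime would lie in both [P] and [Q]. *)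
Lemma independent_separates (F : set (set R)) P Q (r : R) :
  (forall P, F P -> prime_ideal P) -> independent F -> F P -> F Q -> P <> Q ->
  r != 0 -> exists s t u, [/\ ~ P s, ~ Q t & s * t = r * u].
Proof.
move=> Fprime Find FP FQ PQ r0; apply: contrapT => nex.
have /prime_idealP[_ P1 _ PM] := Fprime _ FP.
have /prime_idealP[_ Q1 _ QM] := Fprime _ FQ.
have [|||M [Mprime Mr MS]] := @exists_prime_avoiding
  [set x | exists s t, [/\ ~ P s, ~ Q t & x = s * t]] r.
- by exists 1, 1; rewrite mulr1.
- move=> _ _ [s [t [Ps Qt ->]]] [s' [t' [Ps' Qt' ->]]].
  exists (s * s'), (t * t'); split; [by move=> /PM[]|by move=> /QM[]|ring].
- by move=> u [s [t [Ps Qt e]]]; apply: nex; exists s, t, u.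
apply: (Find P Q) => //; exists M; split=> //; first by exists r.
- by move=> m Mm; apply: contrapT => Pm; apply: (MS m Mm); exists m, 1; rewrite mulr1.
- by move=> m Mm; apply: contrapT => Qm; apply: (MS m Mm); exists 1, m; rewrite mul1r.
Qed.

End Primes.

(** * Localization of fractional ideals at a prime *)

Section Localization.
Local Open Scope classical_set_scope.
Local Open Scope ring_scope.
Variable R : idomainType.
Local Notation K := {fraction R}.
Local Notation "x %:F" := (@FracField.tofrac R x).
Local Notation base := (base_domain R).
Local Notation loc I P := (ideal_mul I (localization P)).
Implicit Types (P Q : set R) (F : set (set R)) (I J M : set K).

Lemma fraction_numden (x : K) : exists a b : R, b != 0 /\ x = a%:F / b%:F.
Proof.
elim/quotW: x => r; exists r.1, r.2.
have d0 := denom_ratioP r; split=> //.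
apply: canRL (mulfK _) _; first by rewrite tofrac_eq0.
unlock FracField.tofrac; rewrite -[LHS]FracField.pi_mul; apply/eqmodP.
rewrite /= FracField.equivfE /FracField.mulf !numden_Ratio ?oner_neq0 ?mulr1 //.
by rewrite mulrC.
Qed.

Lemma subring_base : subring base.
Proof.
split; first by exists 1; rewrite ?tofrac1.
split; first by exists 0; rewrite ?tofrac0.
move=> _ _ _ [a _ <-] [b _ <-] [c _ <-].
by exists (a * b + c); rewrite ?tofracD ?tofracM.
Qed.

Section OnePrime.
Variable P : set R.
Hypothesis Pprime : prime_ideal P.

Lemma prime_ideal0 : P 0. Proof. by case/prime_idealP: Pprime. Qed.

Lemma prime_ideal_not1 : ~ P 1. Proof. by case/prime_idealP: Pprime. Qed.

Lemma prime_ideal_notM s t : ~ P s -> ~ P t -> ~ P (s * t).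
Proof. by case/prime_idealP: Pprime => _ _ _ PM Ps Pt /PM[]. Qed.

Lemma prime_ideal_mull s t : P t -> P (s * t).
Proof.
case/prime_idealP: Pprime => P0 _ PD _ Pt.
by rewrite -[s * t]addr0; apply: PD.
Qed.

Lemma prime_ideal_notMl s t : ~ P (s * t) -> ~ P s /\ ~ P t.
Proof.
move=> Pst; split=> ?; apply: Pst; last exact: prime_ideal_mull.
by rewrite mulrC; apply: prime_ideal_mull.
Qed.

Lemma tofrac_notin_neq0 s : ~ P s -> s%:F != 0.
Proof.
move=> Ps; rewrite tofrac_eq0; apply/eqP => s0.
by apply: Ps; rewrite s0; apply: prime_ideal0.
Qed.

Lemma base_sub_localization : base `<=` localization P.
Proof.
move=> _ [a _ <-]; exists a, 1; rewrite tofrac1 divr1.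
by split=> //; apply: prime_ideal_not1.
Qed.

Lemma localization_frac a s : ~ P s -> localization P (a%:F / s%:F).
Proof. by exists a, s. Qed.

Lemma localization_tofrac a : localization P a%:F.
Proof. by apply: base_sub_localization; exists a. Qed.

Lemma subring_localization : subring (localization P).
Proof.
split; first by rewrite -tofrac1; apply: localization_tofrac.
split; first by rewrite -tofrac0; apply: localization_tofrac.
move=> _ _ _ [a [s [Ps ->]]] [b [t [Pt ->]]] [c [u [Pu ->]]].
exists (a * b * u + c * (s * t)), (s * t * u).
split; first by do 2 apply: prime_ideal_notM => //.
by rewrite mulf_div addf_div ?mulf_neq0 ?tofrac_notin_neq0 // -!tofracM -tofracD.
Qed.

Lemma loc_submodule M : submodule (localization P) M -> loc M P = M.
Proof. by apply: ideal_mul_id; case: subring_localization. Qed.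

Lemma loc_localization : loc (localization P) P = localization P.
Proof. by apply: loc_submodule; case: subring_localization. Qed.

Lemma sub_loc I : I `<=` loc I P.
Proof.
move=> x Ix; rewrite -[x]mulr1; apply: ideal_mulM => //.
by case: subring_localization.
Qed.

Lemma loc_ideal_mul I J : loc (ideal_mul I J) P = ideal_mul (loc I P) (loc J P).
Proof. by rewrite -{1}loc_localization ideal_mulACA. Qed.

Lemma loc_id I : loc (loc I P) P = loc I P.
Proof. by rewrite -ideal_mulA loc_localization. Qed.

(** Elements of the product are finite sums, so the product of the denominators, still outside [P],
    clears all terms at once. *)
Lemma loc_clear I x : submodule base I ->
  loc I P x -> exists s, ~ P s /\ I (s%:F * x).
Proof.
move=> Imod; have ImodM a y : I y -> I (a%:F * y).
  by apply: submoduleM Imod _; exists a.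
move: x; apply: ideal_mul_sub.
- by exists 1; rewrite mulr0; split; [apply: prime_ideal_not1|case: Imod].
- move=> x y [s [Ps Ix]] [t [Pt Iy]]; exists (s * t).
  split; first exact: prime_ideal_notM.
  have -> : (s * t)%:F * (x + y) = t%:F * (s%:F * x) + s%:F * (t%:F * y).
    by rewrite tofracM mulrDr [t%:F * _]mulrCA -!mulrA.
  apply: submoduleD Imod _ _; [by case: subring_base| |]; exact: ImodM.
- move=> x _ Ix [a [s [Ps ->]]]; exists s; split=> //.
  have -> : s%:F * (x * (a%:F / s%:F)) = a%:F * x.
    by rewrite mulrC -mulrA divfK ?tofrac_notin_neq0 // mulrC.
  exact: ImodM.
Qed.

Lemma fractional_loc I :
  fractional_ideal base I -> fractional_ideal (localization P) (loc I P).
Proof.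
move=> Ifrac; have Imod := fractional_submodule Ifrac.
case: Ifrac => [[x Ix x0] _ _ [d [bd d0 dI]]]; split.
- by exists x => //; apply: sub_loc.
- exact: ideal_mul0.
- move=> a y z La Iy Iz; apply: ideal_mulD => //.
  move: y Iy; apply: ideal_mul_sub => [|y y'|y b Iy Lb].
  + by rewrite mulr0; apply: ideal_mul0.
  + by rewrite mulrDr; apply: ideal_mulD.
  + rewrite mulrCA; apply: ideal_mulM => //.
    by apply: submoduleM La Lb; case: subring_localization.
(* The denominator of [I] still works: if [s * y] is in [I] with [s] outside [P], then [d * s * y]
   is some [c] in [R], so [d * y = c / s]. *)
- exists d; split=> //; first exact: base_sub_localization.
  move=> y /(loc_clear Imod)[s [Ps /dI[c _ e]]].
  have -> : d * y = c%:F / s%:F; last exact: localization_frac.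
  by apply: canRL (mulfK (tofrac_notin_neq0 Ps)) _; rewrite e mulrC mulrCA.
Qed.

(** The numerator of a denominator [a / s] suffices, as it differs by a unit of [R_P]. Gluing needs
    denominators taken from [R], which act at all primes simultaneously. *)
Lemma fractional_localization_denom M :
  fractional_ideal (localization P) M ->
  exists2 d : R, d != 0 & forall x, M x -> localization P (d%:F * x).
Proof.
move=> [_ _ _ [_ [[a [s [Ps ->]]] as0 asM]]]; exists a.
  by apply: contra_neq as0 => ->; rewrite tofrac0 mul0r.
move=> x /asM Lx; have -> : a%:F * x = s%:F * (a%:F / s%:F * x).
  by rewrite mulrA [s%:F * _]mulrC divfK ?tofrac_notin_neq0.
apply: submoduleM (localization_tofrac s) Lx.
by case: subring_localization.
Qed.

Lemma fractional_localization_tofrac M :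
  fractional_ideal (localization P) M -> exists2 c : R, c != 0 & M c%:F.
Proof.
move=> Mfrac; have Mmod := fractional_submodule Mfrac.
case: Mfrac => [[x Mx x0] _ _ _].
have [a [b [b0 xE]]] := fraction_numden x; exists a.
  by apply: contra_neq x0 => a0; rewrite xE a0 tofrac0 mul0r.
have -> : a%:F = b%:F * x by rewrite xE mulrC divfK ?tofrac_eq0.
exact: submoduleM Mmod (localization_tofrac b) Mx.
Qed.

End OnePrime.

(** Take a nonzero [a] of [R] in [I] and a denominator [d] of [I]. If [P] misses [a * d], both are
    units of [R_P], which squeezes [I R_P] between [a R_P] and [R_P / d], both equal to [R_P]. So
    every exceptional prime contains [a * d]. *)
Lemma finite_loc_nontrivial F I :
  (forall P, F P -> prime_ideal P) -> finite_character F ->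
  fractional_ideal base I ->
  finite_set [set P | F P /\ loc I P <> localization P].
Proof.
move=> Fprime Ffin Ifrac; have Imod := fractional_submodule Ifrac.
case: Ifrac => [[x Ix x0] _ _ [_ [[d _ <-] d0 dI]]].
have [a [b [b0 xE]]] := fraction_numden x.
have a0 : a != 0 by apply: contra_neq x0 => a0; rewrite xE a0 tofrac0 mul0r.
have Ia : I a%:F.
  have -> : a%:F = b%:F * x by rewrite xE mulrC divfK ?tofrac_eq0.
  by apply: submoduleM Imod _ Ix; exists b.
apply: (@sub_finite_set _ _ [set P | F P /\ P (a * d)]); last first.
  by apply: Ffin; rewrite mulf_neq0 // -tofrac_eq0.
move=> P [FP locP]; split=> //; apply: contrapT => Pad; apply: locP.
have Pp := Fprime _ FP.
have [Pa Pd] := prime_ideal_notMl Pp Pad.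
have [_ Lmod] := subring_localization Pp.
apply/seteqP; split.
  rewrite -[X in _ `<=` X](loc_localization Pp); apply: ideal_mulS => // y /dI[c _ e].
  have -> : y = c%:F / d%:F; last exact: localization_frac.
  by apply: canRL (mulfK (tofrac_notin_neq0 Pp Pd)) _; rewrite e mulrC.
move=> y Ly; have -> : y = a%:F * (1%:F / a%:F * y).
  by rewrite tofrac1 div1r mulVKf ?(tofrac_notin_neq0 Pp).
apply: ideal_mulM => //; apply: submoduleM Lmod _ Ly.
exact: localization_frac.
Qed.

(** * Gluing local fractional ideals *)

Section Gluing.
Variable F : set (set R).
Hypothesis hF : IFC_domain F.
Variable J : set R -> set K.
Hypothesis Jfrac : forall P, F P -> fractional_ideal (localization P) (J P).
Hypothesis Jfin : finite_set [set P | F P /\ J P <> localization P].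

Local Notation glue := (\bigcap_(P in F) J P).

Lemma IFC_prime P : F P -> prime_ideal P.
Proof. by case: hF => [[Fprime _ _] _ _]; apply: Fprime. Qed.

Lemma tofrac_mul_family P a x : F P -> J P x -> J P (a%:F * x).
Proof.
move=> FP; apply: submoduleM (fractional_submodule (Jfrac FP)) _.
exact: localization_tofrac (IFC_prime FP) _.
Qed.

(* Only finitely many Q matter: those with J_Q <> R_Q or containing the
   denominator of [x]; for each of them independence supplies a factor. *)
Lemma glue_clear P x : F P -> J P x -> exists2 s, ~ P s & glue (s%:F * x).
Proof.
move=> FP Jx; have Pp := IFC_prime FP.
have [a [b [b0 xE]]] := fraction_numden x.
have [[_ _ _] Find Ffin] := hF.
pose B := [set Q | F Q /\ J Q <> localization Q] `|` [set Q | F Q /\ Q b].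
have [|||Q s t CQ|Q BQ|s Ps Cs] := @finite_common_multiple R _ [set s | ~ P s]
    B (fun Q => [set s | F Q -> J Q (s%:F * x)]).
- by rewrite finite_setU; split=> //; apply: Ffin.
- exact: prime_ideal_not1.
- exact: prime_ideal_notM.
- by rewrite (mulrC s); split=> FQ; rewrite tofracM -mulrA; apply: tofrac_mul_family => //; apply: CQ.
- have FQ : F Q by case: BQ => -[].
  have [PQ|PQ] := pselect (P = Q).
    exists 1; first exact: prime_ideal_not1 Pp.
    by move=> _; rewrite tofrac1 mul1r -PQ.
  have [c c0 Jc] := fractional_localization_tofrac (IFC_prime FQ) (Jfrac FQ).
  (* Separating with [b * c] gives [s = b * c * u / t], where [t] is a unit of [R_Q]. The factor [b]
     cancels the denominator of [x], and [c] puts the result in [J Q]. *)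
  have [|s [t [u [Ps Qt e]]]] :=
    @independent_separates R F P Q (b * c) IFC_prime Find FP FQ PQ.
    by rewrite mulf_neq0.
  exists s => // _.
  have -> : s%:F * x = (a%:F * u%:F / t%:F) * c%:F.
    have t0 := tofrac_notin_neq0 (IFC_prime FQ) Qt.
    have -> : s%:F = (b * c * u)%:F / t%:F by rewrite -e tofracM mulfK.
    by rewrite xE !tofracM frac_swap // tofrac_eq0.
  rewrite -tofracM; apply: submoduleM (fractional_submodule (Jfrac FQ)) _ Jc.
  exact: localization_frac.
exists s => // Q FQ; have [BQ|nBQ] := pselect (B Q); first exact: Cs.
apply: tofrac_mul_family => //.
have [JQ Qb] : J Q = localization Q /\ ~ Q b.
  split; last by move=> Qb; apply: nBQ; right.
  by apply: contrapT => JQ; apply: nBQ; left.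
by rewrite JQ xE; apply: localization_frac.
Qed.

(** A nonzero element comes from clearing one of a single [J P]. A common denominator is a product
    over the finitely many primes where [J P] is not [R_P]; elsewhere any factor from [R] is
    harmless. *)
Lemma fractional_glue : fractional_ideal base glue.
Proof.
have [[_ _ Rcap] Find Ffin] := hF.
split.
(* For empty [F] the intersection is all of [K], so [1] serves. *)
- have [[P FP]|F0] := pselect (exists P, F P).
    have [[x Jx x0] _ _ _] := Jfrac FP.
    have [s Ps gs] := glue_clear FP Jx.
    exists (s%:F * x); first exact: gs.
    exact: mulf_neq0 (tofrac_notin_neq0 (IFC_prime FP) Ps) x0.
  by exists 1; rewrite ?oner_neq0 // => P FP; case: F0; exists P.
- by move=> P /Jfrac[].
- move=> _ x y [a _ <-] Jx Jy P FP; have [_ _ JP _] := Jfrac FP.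
  by apply: JP; [exact: localization_tofrac (IFC_prime FP) _|exact: Jx|exact: Jy].
- have Lmul Q a x : F Q -> localization Q x -> localization Q (a%:F * x).
    move=> FQ Lx; have [_ Lmod] := subring_localization (IFC_prime FQ).
    by apply: submoduleM Lmod _ Lx; apply: localization_tofrac (IFC_prime FQ) _.
  have [||Q s t CQ|Q [FQ _]|d d0 dJ] := @finite_common_multiple R _
    [set d | d != 0] _
    (fun Q => [set d | F Q -> forall x, J Q x -> localization Q (d%:F * x)]) Jfin.
  + exact: oner_neq0.
  + by move=> s t /= s0 t0; rewrite mulf_neq0.
  + by rewrite (mulrC s); split=> FQ x Jx; rewrite tofracM -mulrA;
      apply: Lmul => //; apply: CQ.
  + have [d d0 dJ] := fractional_localization_denom (IFC_prime FQ) (Jfrac FQ).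
    by exists d => // _.
  exists d%:F; split; [by exists d|by rewrite tofrac_eq0|].
  move=> x Jx; rewrite Rcap => Q FQ.
  have [JQ|JQ] := pselect (J Q = localization Q); last by apply: dJ => //; apply: Jx.
  by apply: Lmul => //; rewrite -JQ; apply: Jx.
Qed.

Lemma loc_glue P : F P -> loc glue P = J P.
Proof.
move=> FP; have Pp := IFC_prime FP; apply/seteqP; split=> [|x Jx].
  rewrite -[X in _ `<=` X](loc_submodule Pp (fractional_submodule (Jfrac FP))).
  by apply: ideal_mulS => // x; apply.
have [s Ps gs] := glue_clear FP Jx.
have -> : x = (s%:F * x) * (1%:F / s%:F).
  by rewrite tofrac1 div1r [RHS]mulrC mulKf ?(tofrac_notin_neq0 Pp).
by apply: ideal_mulM => //; apply: localization_frac.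
Qed.

End Gluing.

(** * Testing regularity and stability locally *)

Section StarRegularity.
Variable F : set (set R).
Hypothesis hF : IFC_domain F.

Lemma exists_loc_eq P M : F P -> fractional_ideal (localization P) M ->
  exists2 I, fractional_ideal base I & loc I P = M.
Proof.
move=> FP Mfrac.
(* Prescribe [M] at [P] and the trivial ideal at all other primes, so at most one prime is
   exceptional. *)
pose J Q := if `[< Q = P >] then M else localization Q.
have JP : J P = M by rewrite /J; case: asboolP.
have Jfrac Q : F Q -> fractional_ideal (localization Q) (J Q).
  move=> FQ; rewrite /J; case: asboolP => [->//|_].
  exact: fractional_subring (subring_localization (IFC_prime hF FQ)).
have Jfin : finite_set [set Q | F Q /\ J Q <> localization Q].
  apply: (@sub_finite_set _ _ [set P]); last exact: finite_set1.
  by move=> Q [_]; rewrite /J; case: asboolP.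
by exists (\bigcap_(Q in F) J Q); [exact: fractional_glue|rewrite loc_glue].
Qed.

(** [star_of F I] lies between [I] and [I R_P], and these two have the same localization at [P]. *)
Lemma loc_star_of I P : F P -> loc (star_of F I) P = loc I P.
Proof.
move=> FP; have Pp := IFC_prime hF FP; apply/seteqP; split.
  rewrite -[X in _ `<=` X](loc_id Pp); apply: ideal_mulS => // x; exact.
by apply: ideal_mulS => // x Ix Q FQ; apply: (sub_loc (IFC_prime hF FQ)).
Qed.

Lemma star_of_eq I J : star_of F I = star_of F J <->
  forall P, F P -> loc I P = loc J P.
Proof.
split=> [e P FP|e]; first by rewrite -(loc_star_of I FP) e loc_star_of.
exact: eq_bigcapr.
Qed.

Lemma clifford_star_regularE :
  clifford_star_regular base (star_of F) <->
  forall P, F P -> clifford_regular (localization P).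
Proof.
split=> [creg P FP M Mfrac|creg I Ifrac].
  have Pp := IFC_prime hF FP.
  have [I Ifrac <-] := exists_loc_eq FP Mfrac.
  have [J Jfrac /star_of_eq/(_ P FP) e] := creg I Ifrac.
  exists (loc J P); first exact: fractional_loc.
  by rewrite {1}e !(loc_ideal_mul Pp).
(* The last clause makes the choice trivial wherever [I] is locally trivial, which leaves finitely
   many exceptional primes, as gluing demands. *)
have /choice[J HJ] : forall P, exists J, F P ->
    [/\ fractional_ideal (localization P) J,
        loc I P = ideal_mul (ideal_mul (loc I P) (loc I P)) J &
        loc I P = localization P -> J = localization P].
  move=> P; have [FP|nFP] := pselect (F P); last by exists setT => /nFP.
  have Pp := IFC_prime hF FP; have [L1 Lmod] := subring_localization Pp.
  have [e|ne] := pselect (loc I P = localization P).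
    exists (localization P) => _.
    by rewrite e !(loc_localization Pp); split=> //; apply: fractional_subring.
  have [J Jfrac e] := creg P FP _ (fractional_loc Pp Ifrac).
  by exists J.
have Jfrac P : F P -> fractional_ideal (localization P) (J P) by case/HJ.
have Jfin : finite_set [set P | F P /\ J P <> localization P].
  have [[Fprime _ _] _ Ffin] := hF.
  apply: sub_finite_set (finite_loc_nontrivial Fprime Ffin Ifrac).
  by move=> P [FP JP]; split=> // locP; apply: JP; have [_ _] := HJ _ FP; apply.
exists (\bigcap_(P in F) J P); first exact: fractional_glue.
apply/star_of_eq => P FP; have [_ e _] := HJ _ FP.
by rewrite !(loc_ideal_mul (IFC_prime hF FP)) (loc_glue hF Jfrac Jfin FP).
Qed.

(** Stated for a single ideal so that it serves both directions of the equivalence. Both colons over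
    [R] are glued from their local counterparts, so they localize to them. *)
Lemma star_stable_at I : fractional_ideal base I ->
  let E := colon (star_of F I) (star_of F I) in
  star_of F (ideal_mul (star_of F I) (colon E (star_of F I))) = E <->
  forall P, F P ->
  let E_P := colon (loc I P) (loc I P) in
  ideal_mul (loc I P) (colon E_P (loc I P)) = E_P.
Proof.
move=> Ifrac E; pose E_ P := colon (loc I P) (loc I P).
have [[Fprime _ _] _ Ffin] := hF.
have Lring P FP := subring_localization (Fprime P FP).
have locfrac P (FP : F P) := fractional_loc (Fprime P FP) Ifrac.
have Efrac P : F P -> fractional_ideal (localization P) (E_ P).
  by move=> FP; apply: fractional_colon; auto.
have Tfrac P : F P -> fractional_ideal (localization P) (colon (E_ P) (loc I P)).
  by move=> FP; apply: fractional_colon; auto.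
(* The colon sees only the localization of [star_of F I] at [P], which is that of [I]. *)
have colon_star M P : F P -> submodule (localization P) M ->
    colon M (star_of F I) = colon M (loc I P).
  move=> FP Mmod; have [L1 _] := Lring _ FP.
  by rewrite -(colon_ideal_mul _ L1 Mmod) loc_star_of.
have Efin : finite_set [set P | F P /\ E_ P <> localization P].
  apply: sub_finite_set (finite_loc_nontrivial Fprime Ffin Ifrac).
  move=> P [FP EP]; split=> // e; apply: EP.
  by rewrite /E_ e colon_subring //; apply: Lring.
have Tfin : finite_set [set P | F P /\ colon (E_ P) (loc I P) <> localization P].
  apply: sub_finite_set (finite_loc_nontrivial Fprime Ffin Ifrac).
  move=> P [FP EP]; split=> // e; apply: EP.
  by rewrite /E_ e !colon_subring //; apply: Lring.
have EE : E = \bigcap_(P in F) E_ P.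
  rewrite /E {1}/star_of colon_bigcap; apply: eq_bigcapr => P FP.
  by apply: colon_star => //; apply: fractional_submodule (locfrac _ FP).
have TE : colon E (star_of F I) = \bigcap_(P in F) colon (E_ P) (loc I P).
  rewrite EE colon_bigcap; apply: eq_bigcapr => P FP.
  by apply: colon_star => //; apply: fractional_submodule (Efrac _ FP).
have locE P : F P -> loc E P = E_ P by move=> FP; rewrite EE loc_glue.
(* Since [E] is closed under the star operation, the stability equation becomes an equality of two
   stars, which is tested prime by prime. *)
have starE : star_of F E = E.
  by rewrite {2}EE; apply: eq_bigcapr => P; apply: locE.
rewrite -{2}starE star_of_eq.
have locT P : F P -> loc (ideal_mul (star_of F I) (colon E (star_of F I))) P =
    ideal_mul (loc I P) (colon (E_ P) (loc I P)).
  move=> FP; rewrite (loc_ideal_mul (Fprime _ FP)) loc_star_of // TE.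
  by rewrite (loc_glue hF Tfrac Tfin).
by split=> stab P FP; have := stab P FP; rewrite locT // locE.
Qed.

Lemma star_stableE :
  star_stable base (star_of F) <-> forall P, F P -> stable (localization P).
Proof.
split=> [stab P FP M Mfrac|stab I Ifrac].
  have [I Ifrac <-] := exists_loc_eq FP Mfrac.
  exact: (star_stable_at Ifrac).1 (stab I Ifrac) P FP.
apply/(star_stable_at Ifrac) => P FP.
exact: stab P FP _ (fractional_loc (IFC_prime hF FP) Ifrac).
Qed.

End StarRegularity.

End Localization.

Theorem proposition2p15 (R : idomainType) (F : set (set R)) (hF : IFC_domain F) :
  (clifford_star_regular (base_domain R) (star_of F) <->
     (forall P : set R, F P -> clifford_regular (localization P)))
  /\
  (star_stable (base_domain R) (star_of F) <->
     (forall P : set R, F P -> stable (localization P))).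
Proof. by split; [exact: clifford_star_regularE|exact: star_stableE]. Qed.
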